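(* Let $L\ge3$ and $\lambda>0$. Among all $\bm a\in\{0,1\}^L$ with $\mathrm{wt}(\bm a)=1$, the largest eigenvalue of $\hat\Pi^{(\mathrm{ph})}_{\bm a}-\lambda\hat\Pi$ (as an operator on $\mathbb C^L$) is maximized at $\bm a=0100\cdots0$, i.e. at $a_2=1$ and $a_i=0$ for $i\ne2$.
   Context: Work in $\mathbb C^L$ with orthonormal basis $\{|1\rangle,\dots,|L\rangle\}$; $\hat P(|\psi\rangle)=|\psi\rangle\langle\psi|$ and $\delta$ is the Kronecker delta. For $\bm a\in\{0,1\}^L$, $\mathrm{wt}(\bm a)$ is the number of $1$'s. $\hat\Pi$ is the real symmetric tridiagonal $L\times L$ matrix with $\langle i|\hat\Pi|i\rangle=1/2$ for $1\le i\le L$, $\langle i|\hat\Pi|i+1\rangle=\langle i+1|\hat\Pi|i\rangle=-1/(2\sqrt2)$ for $i\in\{1,L-1\}$, and $\langle i|\hat\Pi|i+1\rangle=\langle i+1|\hat\Pi|i\rangle=-1/4$ for $2\le i\le L-2$ (all other entries zero). For $\bm a\in\{0,1\}^L$, $\hat\Pi^{(\mathrm{ph})}_{\bm a}$ is the diagonal operator $$\hat\Pi^{(\mathrm{ph})}_{\bm a}=\delta_{a_2,1}\hat P(|1\rangle)+\sum_{i=2}^{L-1}\frac{\delta_{a_{i-1},1}+\delta_{a_{i+1},1}}{2}\hat P(|i\rangle)+\delta_{a_{L-1},1}\hat P(|L\rangle).$$ *)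

(* Defs.v *)
From HB Require Import structures.
From mathcomp Require Import all_boot all_order all_algebra.
From mathcomp Require Import all_reals.
From mathcomp Require Import complex.
Set Implicit Arguments. Unset Strict Implicit. Unset Printing Implicit Defensive.
Import Order.TTheory GRing.Theory Num.Theory.
Local Open Scope ring_scope.

(* Convention: sites 1..L of the paper are the ordinals 0..L-1 of 'I_L,
   i.e. paper site i corresponds to ordinal i-1.  A bit string
   a in {0,1}^L is a function 'I_L -> bool. *)

Definition wt (L : nat) (a : 'I_L -> bool) : nat := #|[set i | a i]|.

(* a_k with 0-based nat index k (false outside range, never used there) *)
Definition bit (L : nat) (a : 'I_L -> bool) (k : nat) : bool :=
  match (insub k : option 'I_L) with Some i => a i | None => false end.

(* the string 0100...0 : paper a_2 = 1, i.e. 0-based index 1 *)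
Definition e2 (L : nat) : 'I_L -> bool := fun i => nat_of_ord i == 1%N.

Definition Pi_off (R : realType) (L k : nat) : R :=
  if (k == 0%N) || (k == (L - 2)%N) then - 1 / (2 * Num.sqrt 2)
  else - 1 / 4.

Definition Pi_mx (R : realType) (L : nat) : 'M[R]_L :=
  \matrix_(i < L, j < L)
    if i == j then 1 / 2
    else if nat_of_ord j == i.+1 then Pi_off R L i
    else if nat_of_ord i == j.+1 then Pi_off R L j
    else 0.

Definition Piph_diag (R : realType) (L : nat) (a : 'I_L -> bool) (k : nat) : R :=
  if k == 0%N then (bit a 1)%:R
  else if k == L.-1 then (bit a (L - 2))%:R
  else ((bit a k.-1)%:R + (bit a k.+1)%:R) / 2.

Definition Piph_mx (R : realType) (L : nat) (a : 'I_L -> bool) : 'M[R]_L :=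
  \matrix_(i < L, j < L) if i == j then Piph_diag R a i else 0.

Definition Hmx (R : realType) (L : nat) (lam : R) (a : 'I_L -> bool)
  : 'M[R[i]]_L :=
  map_mx (fun x : R => (x%:C)%C) (Piph_mx R a - lam *: Pi_mx R L).

Definition is_largest_eigenvalue (C : numFieldType) (n : nat) (A : 'M[C]_n)
  (m : C) : Prop :=
  eigenvalue A m /\ forall mu, eigenvalue A mu -> mu <= m.

(* Main.v *)
Require Import Defs.
From HB Require Import structures.
From mathcomp Require Import all_boot all_order all_algebra.
From mathcomp Require Import all_reals.
From mathcomp Require Import complex.
From mathcomp Require Import spectral ring lra zify.
Set Implicit Arguments.
Unset Strict Implicit.
Unset Printing Implicit Defensive.

Import Order.TTheory GRing.Theory Num.Theory.
Local Open Scope ring_scope.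

(* Substituting [v_i = sqrt(w_i) f_i] with [w = (1, 2, ..., 2, 1)] turns the
   eigenvalue problem on sites [0..N] ([N = L - 1]) into
   [E w f = V f - (lam / 2) Lap f], where [Lap] is the Laplacian of the path and
   [V] is the indicator of the neighbours of the marked site [j].  For [E > 0]
   the operator [E w + (lam / 2) Lap] has a Green function that is a product of
   two hyperbolic cosines, so [E] is governed by a 2x2 matrix of values of this
   Green function at [j - 1] and [j + 1].  With [u = N - 2 j], its quadratic form
   only involves [cosh] at [u + 2], [u], [u - 2] (and constants), and its maximum
   over the unit circle grows with [|u|]; hence the marked site [j = 1] wins.  A
   superposition of two Green functions then serves as a trial vector for
   [0100...0] whose Rayleigh quotient is at least [E]. *)

(** * Real eigenvectors and the Rayleigh bound for symmetric matrices *)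

(** Since [B] and [m] are real, the real and imaginary parts of a complex eigenvector satisfy the
    same equation, and at least one of them is nonzero. *)
Lemma eigenvalue_map_real (R : rcfType) (n : nat) (B : 'M[R]_n) (m : R) :
  eigenvalue (map_mx (real_complex R) B) (real_complex R m) ->
  exists2 v : 'rV[R]_n, v != 0 & v *m B = m *: v.
Proof.
case/eigenvalueP => v vB v0.
pose re := \row_j complex.Re (v 0 j); pose im := \row_j complex.Im (v 0 j).
have vE : v = map_mx (real_complex R) re + 'i%C *: map_mx (real_complex R) im.
  by apply/rowP => j; rewrite !mxE -complexE.
have parts (j : 'I_n) : (re *m B) 0 j = m * re 0 j /\ (im *m B) 0 j = m * im 0 j.
  have := congr1 (fun w : 'rV_n => w 0 j) vB.
  rewrite {1}vE mulmxDl -scalemxAl -!map_mxM !mxE => /eqP.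
  case: (v 0 j) => a b; rewrite eq_complex /=.
  by rewrite !(mulr0, mul0r, addr0, subr0, mul1r, add0r) => /andP[/eqP-> /eqP->].
have [re0|re0] := eqVneq re 0; last first.
  by exists re => //; apply/rowP => j; rewrite (parts j).1 !mxE.
exists im; last by apply/rowP => j; rewrite (parts j).2 !mxE.
by apply: contra v0 => /eqP im0; rewrite vE re0 im0 !map_mx0 scaler0 addr0.
Qed.

(** Unitary diagonalisation over [R[i]]: the spectrum is real and every Rayleigh quotient is a
    weighted mean of it. The real eigenvector is used for an arbitrary marked site, the Rayleigh
    bound for [0100...0]. *)
Lemma symmetric_top_eigenvalue (R : rcfType) (n : nat) (B : 'M[R]_n.+1) :
  B^T = B ->
  exists m : R,
    [/\ is_largest_eigenvalue (map_mx (real_complex R) B) (real_complex R m),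
        exists2 v : 'rV[R]_n.+1, v != 0 & v *m B = m *: v
      & forall v : 'rV[R]_n.+1, (v *m B *m v^T) 0 0 <= m * (v *m v^T) 0 0].
Proof.
move=> Bsym; set A := map_mx _ B.
have Areal : A \is a realmx.
  by apply/mxOverP => i j; rewrite mxE; apply/complex_realP; exists (B i j).
have Aherm : A \is hermsymmx.
  apply: realsym_hermsym => //; apply/is_hermitianmxP.
  by rewrite expr0 scale1r map_mx_id // map_trmx Bsym.
have /hermitian_normalmx/orthomx_spectralP := Aherm.
have /mxOverP dreal := hermitian_spectral_diag_real Aherm.
have Punit := spectral_unit A.
have := invmx_unitary (spectral_unitarymx A).
set P := spectralmx A in Punit *; set d := spectral_diag A in dreal *.
move=> PV AE.
have dE k : real_complex R (complex.Re (d 0 k)) = d 0 k by exact: RRe_real.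
case: (@arg_maxP _ _ _ (ord0 : 'I_n.+1) predT (fun k => complex.Re (d 0 k)) isT) => k0 _ k0max.
have dk0 k : d 0 k <= d 0 k0 by rewrite -(dE k) -(dE k0) lecR; exact: k0max.
have diagr (u : 'rV_n.+1) k : (u *m diag_mx d) 0 k = u 0 k * d 0 k.
  by rewrite mul_mx_diag mxE.
(* The rows of [P] are left eigenvectors of [A]; row [k0] belongs to the largest diagonal entry. *)
have top : eigenvalue A (real_complex R (complex.Re (d 0 k0))).
  rewrite dE; apply/eigenvalueP; exists (row k0 P).
    by rewrite AE !mulmxA -row_mul mulmxV // row1 -rowE row_diag_mx -scalemxAl -rowE.
  apply/eqP => row0; have := congr1 (row k0) (mulmxV Punit).
  rewrite row_mul row0 mul0mx row1 => /rowP/(_ k0)/eqP.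
  by rewrite !mxE !eqxx eq_sym oner_eq0.
exists (complex.Re (d 0 k0)); split; last 1 first.
- move=> v.
  rewrite -lecR.
  pose vC := map_mx (real_complex R) v.
  pose u := vC *m invmx P.
  have vCH : (map_mx Num.conj vC)^T = map_mx (real_complex R) v^T.
    apply/matrixP => i j; rewrite !mxE; apply: conj_Creal.
    by apply/complex_realP; eexists.
  have uH : (map_mx Num.conj u)^T = P *m map_mx (real_complex R) v^T.
    rewrite map_mxM trmx_mul vCH; congr (_ *m _).
    by apply/matrixP => i j; rewrite PV !mxE; apply: conjCK.
  (* In the eigenbasis both quadratic forms become sums over [|u_k|^2], compared term by term
     below. *)
  have formE : real_complex R ((v *m B *m v^T) 0 0) = \sum_k d 0 k * `|u 0 k| ^+ 2.
    transitivity ((u *m diag_mx d *m (map_mx Num.conj u)^T) 0 0).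
      by rewrite uH /u !mulmxA -2!(mulmxA vC) -AE -!map_mxM [RHS]mxE.
    by rewrite mxE; apply: eq_bigr => k _; rewrite diagr !mxE normCK mulrAC mulrC.
  have normE : real_complex R ((v *m v^T) 0 0) = \sum_k `|u 0 k| ^+ 2.
    transitivity ((u *m (map_mx Num.conj u)^T) 0 0).
      by rewrite uH /u mulmxA mulmxKV // -map_mxM [RHS]mxE.
    by rewrite mxE; apply: eq_bigr => k _; rewrite !mxE normCK.
  rewrite rmorphM /= dE formE normE mulr_sumr; apply: ler_sum => k _.
  by rewrite ler_wpM2r // exprn_ge0.
- split=> // mu /eigenvalueP[v vA v0]; rewrite dE.
  pose u := v *m invmx P.
  have uD : u *m diag_mx d = mu *: u.
    by rewrite scalemxAl -vA AE !mulmxA mulmxK.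
  have : u != 0.
    by apply: contraNneq v0 => u0; rewrite -(mulmxKV Punit v) -/u u0 mul0mx.
  (* A nonzero coordinate [u_k] forces [mu = d_k]. *)
  case/rV0Pn => k uk.
  have := congr1 (fun w : 'rV_n.+1 => w 0 k) uD; rewrite diagr [RHS]mxE mulrC => /eqP.
  by rewrite -subr_eq0 -mulrBl mulf_eq0 (negPf uk) orbF subr_eq0 => /eqP <-.
- exact: eigenvalue_map_real.
Qed.

(** * Hyperbolic cosines at integer arguments *)

(* Twice the hyperbolic cosine of [k * ln x]. *)
Definition dcosh {R : unitRingType} (x : R) (k : int) : R := x ^ k + x ^ (- k).

Lemma dcoshM (R : fieldType) (x : R) (a b : int) : x != 0 ->
  dcosh x a * dcosh x b = dcosh x (a + b) + dcosh x (a - b).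
Proof.
by move=> x0; rewrite /dcosh !opprD !opprK !expfzDr //; ring.
Qed.

Lemma dcoshN (R : unitRingType) (x : R) (k : int) : dcosh x (- k) = dcosh x k.
Proof. by rewrite /dcosh opprK addrC. Qed.

Lemma dcosh0 (R : unitRingType) (x : R) : dcosh x 0 = 2.
Proof. by rewrite /dcosh oppr0 expr0z. Qed.

Lemma dcosh_abs (R : unitRingType) (x : R) (k : int) : dcosh x `|k| = dcosh x k.
Proof. by case: (ger0P k) => _; rewrite ?dcoshN. Qed.

(** For [1 <= x] and [0 <= a <= b] both factors are visibly nonnegative, which gives monotonicity in
    the absolute value. *)
Lemma dcoshB (R : fieldType) (x : R) (a b : int) : x != 0 ->
  dcosh x b - dcosh x a = (x ^ b - x ^ a) * (1 - x ^ (- (a + b))).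
Proof.
move=> x0; rewrite mulrBl !mulrBr -!expfzDr // /dcosh.
have -> : b - (a + b) = - a by ring.
have -> : a - (a + b) = - b by ring.
ring.
Qed.

Lemma dcosh_le (R : realFieldType) (x : R) (a b : int) : 1 <= x ->
  `|a| <= `|b| -> dcosh x a <= dcosh x b.
Proof.
move=> x1 ab; rewrite -(dcosh_abs x a) -(dcosh_abs x b) -subr_ge0 dcoshB.
  apply: mulr_ge0; rewrite subr_ge0; first exact: ler_weXz2l.
  by rewrite -(expr0z x) ler_weXz2l // oppr_le0 addr_ge0.
by rewrite gt_eqF // (lt_le_trans ltr01).
Qed.

Lemma dcosh_lt (R : realFieldType) (x : R) (a b : int) : 1 < x ->
  `|a| < `|b| -> dcosh x a < dcosh x b.
Proof.
move=> x1 ab; rewrite -(dcosh_abs x a) -(dcosh_abs x b) -subr_gt0 dcoshB.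
  apply: mulr_gt0; rewrite subr_gt0; first by rewrite ltr_eXz2l.
  by rewrite -(expr0z x) ltr_eXz2l // oppr_lt0 ltr_wpDl // (le_lt_trans _ ab).
by rewrite gt_eqF // (lt_trans ltr01).
Qed.

(** The witness is the larger root of [x^2 - 2 c x + 1]; with it the recurrence of constant [c] is
    solved by [dcosh x]. *)
Lemma dcosh1_surj (R : rcfType) (c : R) : 1 < c ->
  exists2 x : R, 1 < x & dcosh x 1 = 2 * c.
Proof.
move=> c1; have d0 : 0 <= c ^+ 2 - 1 by nra.
have s0 := sqrtr_ge0 (c ^+ 2 - 1); have := sqr_sqrtr d0.
set s := Num.sqrt _ in s0 * => ss.
exists (c + s); first by lra.
rewrite /dcosh expr1z.
have x0 : c + s != 0 by rewrite gt_eqF; lra.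
apply: (mulfI x0); rewrite mulrDr exprN1 mulfV //.
by nra.
Qed.

(** * The path operator and its Green function *)

(** For [N > 0] this is the degree of site [j] in the path, so that [path_op N 1] is the graph
    Laplacian. *)
Definition end_weight {R : pzSemiRingType} (N j : nat) : R :=
  if (j == 0%N) || (j == N) then 1 else 2.

(* [c w - A], with [A] the adjacency operator of the path on [0..N]. *)
Definition path_op {R : pzRingType} (N : nat) (c : R) (f : nat -> R) (j : nat) : R :=
  c * end_weight N j * f j - (if j == 0%N then 0 else f j.-1)
  - (if j == N then 0 else f j.+1).

(** Summation by parts: exchanging [f] and [g] swaps the two shift terms. *)
Lemma path_op_sym (R : comPzRingType) (N : nat) (c : R) (f g : nat -> R) :
  \sum_(j < N.+1) g j * path_op N c f j = \sum_(j < N.+1) f j * path_op N c g j.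
Proof.
have down (u v : nat -> R) : \sum_(j < N.+1) u j * (if j == 0%N :> nat then 0 else v j.-1)
    = \sum_(j < N) u j.+1 * v j.
  by rewrite big_ord_recl /= mulr0 add0r.
have up (u v : nat -> R) : \sum_(j < N.+1) u j * (if j == N :> nat then 0 else v j.+1)
    = \sum_(j < N) v j.+1 * u j.
  rewrite big_ord_recr /= eqxx mulr0 addr0; apply: eq_bigr => j _.
  by rewrite ltn_eqF // mulrC.
rewrite /path_op.
under eq_bigr do rewrite !mulrBr; under [RHS]eq_bigr do rewrite !mulrBr.
rewrite !sumrB !down !up -!addrA; congr (_ + _); last by rewrite addrC.
by apply: eq_bigr => j _; ring.
Qed.

(* Inverts [path_op] up to a factor, when [2 * c = x + x^-1]. *)
Definition green {R : unitRingType} (x : R) (N y i : nat) : R :=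
  dcosh x (minn i y)%:Z * dcosh x (N%:Z - (maxn i y)%:Z).

Lemma green_left (R : unitRingType) (x : R) (N y i : nat) : (i <= y)%N ->
  green x N y i = dcosh x i%:Z * dcosh x (N%:Z - y%:Z).
Proof. by move=> iy; rewrite /green (minn_idPl iy) (maxn_idPr iy). Qed.

Lemma green_right (R : unitRingType) (x : R) (N y i : nat) : (y <= i)%N ->
  green x N y i = dcosh x y%:Z * dcosh x (N%:Z - i%:Z).
Proof. by move=> yi; rewrite /green (minn_idPr yi) (maxn_idPl yi). Qed.

(** Away from [y] this is the recurrence of [dcosh]; at the ends it holds because [dcosh x 0 = 2]
    and [dcosh x 1 = 2 * c]. At [i = y] the terms in [2 i - N] cancel, so the source strength is the
    same for every [y]. *)
Lemma path_op_green (R : realFieldType) (x c : R) (N y i : nat) :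
  x != 0 -> dcosh x 1 = 2 * c -> (0 < N)%N -> (y <= N)%N -> (i <= N)%N ->
  path_op N c (green x N y) i =
  (i == y)%:R * (dcosh x (N%:Z + 1) - dcosh x (N%:Z - 1)).
Proof.
move=> x0 cE N0 yN iN; rewrite /path_op /end_weight.
have rec k : 2 * c * dcosh x k = dcosh x (k + 1) + dcosh x (k - 1).
  by rewrite -cE mulrC dcoshM.
have rec' (k l m : int) : l = k + 1 -> m = k - 1 ->
    2 * c * dcosh x k = dcosh x l + dcosh x m by move=> -> ->.
case: (ltngtP i y) => iy.
- have -> : (i == N) = false by lia.
  rewrite mul0r orbF.
  case: i iN iy => [|i] iN iy /=; rewrite !green_left; try lia.
    by rewrite dcosh0 cE; ring.
  have := rec' i.+1%:Z i.+2%:Z i%:Z ltac:(lia) ltac:(lia).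
  move/(congr1 ( *%R^~ (dcosh x (N%:Z - y%:Z)))).
  by move=> /= H; lra.
- have -> : (i == 0%N) = false by lia.
  rewrite mul0r.
  case: i iN iy => [|i] // iN iy /=.
  have [iNe|iNe] := eqVneq i.+1 N.
    rewrite !green_right; try lia.
    rewrite -iNe subrr dcosh0.
    have -> : i.+1%:Z - i%:Z = 1 by lia.
    by rewrite cE; ring.
  rewrite !green_right; try lia.
  have := rec' (N%:Z - i.+1%:Z) (N%:Z - i%:Z) (N%:Z - i.+2%:Z) ltac:(lia) ltac:(lia).
  move/(congr1 (GRing.mul (dcosh x y%:Z))).
  by move=> /= H; lra.
- subst y; rewrite mul1r.
  have prodE (k l p q : int) : p = k + l -> q = k - l ->
      dcosh x k * dcosh x l = dcosh x p + dcosh x q.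
    by move=> -> ->; rewrite dcoshM.
  have [i0|i0] := posnP i.
    subst i; rewrite ltn_eqF // green_left // green_right //= !subr0 dcosh0.
    rewrite -[1%:Z]/(1 : int); have := rec N%:Z; lra.
  have [iNe|iNe] := eqVneq i N.
    subst N; rewrite orbT green_right // green_left ?leq_pred // subrr dcosh0.
    have -> : i.-1%:Z = i%:Z - 1 by lia.
    have := rec i%:Z; lra.
  rewrite green_right // green_left ?leq_pred // green_right //=.
  have i1 : (i.-1)%:Z = i%:Z - 1 by lia.
  rewrite (prodE i%:Z (N%:Z - i%:Z) N%:Z (i%:Z *+ 2 - N%:Z)); [|lia|lia].
  rewrite (prodE i.-1%:Z (N%:Z - i%:Z) (N%:Z - 1) (i%:Z *+ 2 - N%:Z - 1)); [|lia|lia].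
  rewrite (prodE i%:Z (N%:Z - i.+1%:Z) (N%:Z - 1) (i%:Z *+ 2 - N%:Z + 1)); [|lia|lia].
  have := rec N%:Z; have := rec (i%:Z *+ 2 - N%:Z); lra.
Qed.

(** Product-to-sum confines the dependence on the site to one term; the other is common to all
    sites. *)
Lemma green_diag (R : fieldType) (x : R) (N y : nat) : x != 0 ->
  green x N y y = dcosh x N%:Z + dcosh x (N%:Z - y%:Z *+ 2).
Proof.
move=> x0; rewrite green_left // dcoshM // -[X in _ + X = _]dcoshN.
by congr (dcosh x _ + dcosh x _); lia.
Qed.

Lemma green_gap (R : fieldType) (x : R) (N y : nat) : x != 0 ->
  green x N y y.+2 = dcosh x (N%:Z - 2) + dcosh x (N%:Z - y.+1%:Z *+ 2).
Proof.
move=> x0; rewrite green_right ?leqW // dcoshM // -[X in _ + X = _]dcoshN.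
by congr (dcosh x _ + dcosh x _); lia.
Qed.

Lemma greenC (R : unitRingType) (x : R) (N y i : nat) :
  green x N y i = green x N i y.
Proof. by rewrite /green minnC maxnC. Qed.

(** * Maximising the two-site quadratic form *)

(* Ordering [|p|, |q|] decreasingly makes this a rearrangement inequality, using
   that [dcosh x (u + 2) + dcosh x (u - 2)] is [dcosh x 2 * dcosh x u]. *)
Lemma two_site_form_le (R : realFieldType) (x p q : R) (N : nat) (u : int) :
  1 <= x -> (2 <= N)%N -> `|u| <= N%:Z - 2 ->
  exists p' q' : R, p' ^+ 2 + q' ^+ 2 = p ^+ 2 + q ^+ 2 /\
    p ^+ 2 * dcosh x (u + 2) + 2 * p * q * (dcosh x (N%:Z - 2) + dcosh x u)
      + q ^+ 2 * dcosh x (u - 2) <=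
    p' ^+ 2 * dcosh x N%:Z
      + 2 * p' * q' * (dcosh x (N%:Z - 2) + dcosh x (N%:Z - 2))
      + q' ^+ 2 * dcosh x (N%:Z - 4).
Proof.
move=> x1 N2 uN; have x0 : x != 0 by rewrite gt_eqF // (lt_le_trans ltr01).
have sumE : dcosh x u * dcosh x 2 = dcosh x (u + 2) + dcosh x (u - 2).
  by rewrite dcoshM.
have sumN : dcosh x (N%:Z - 2) * dcosh x 2 = dcosh x N%:Z + dcosh x (N%:Z - 4).
  by rewrite dcoshM // subrK; congr (_ + dcosh x _); lia.
have le1 : dcosh x (u + 2) <= dcosh x N%:Z by apply: dcosh_le => //; lia.
have le2 : dcosh x (u - 2) <= dcosh x N%:Z by apply: dcosh_le => //; lia.
have le3 : dcosh x u <= dcosh x (N%:Z - 2) by apply: dcosh_le => //; lia.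
have ge k : 2 <= dcosh x k by rewrite -(dcosh0 x); apply: dcosh_le.
move: sumE sumN le1 le2 le3 (ge 2) (ge u) (ge (N%:Z - 2)).
move: (dcosh x u) (dcosh x (u + 2)) (dcosh x (u - 2)) (dcosh x N%:Z)
  (dcosh x (N%:Z - 2)) (dcosh x (N%:Z - 4)) (dcosh x 2).
move=> U S T A B Z D sumE sumN le1 le2 le3 D2 U2 B2.
have pq : p * q <= `|p| * `|q| by rewrite -normrM ler_norm.
have pq0 : 0 <= `|p| * `|q| by rewrite mulr_ge0.
have p2 := real_normK (num_real p); have q2 := real_normK (num_real q).
have TE : T = U * D - S by rewrite sumE; ring.
have ZE : Z = B * D - A by rewrite sumN; ring.
have cross : 2 * p * q * (B + U) <= 2 * (`|p| * `|q|) * (B + B).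
  by rewrite -mulrA -(mulrA 2); nra.
have UD : U * D <= B * D by rewrite ler_wpM2r //; lra.
(* The larger amplitude goes with the larger coefficient [A]. If [|q| <= |p|], the diagonal part is
   [(p^2 - q^2) S + q^2 U D], with nonnegative multipliers of [S] and [U D], so [S <= A] and
   [U D <= B D] apply; the other case is symmetric. *)
case: (leP `|q| `|p|) => pqle.
  exists `|p|, `|q|; rewrite p2 q2; split=> //.
  have h : q ^+ 2 <= p ^+ 2 by rewrite -p2 -q2 lerXn2r ?nnegrE.
  have := ler_wpM2l (_ : 0 <= p ^+ 2 - q ^+ 2) le1; rewrite subr_ge0 => /(_ h).
  have := ler_wpM2l (sqr_ge0 q) UD; rewrite TE ZE; lra.
exists `|q|, `|p|; rewrite p2 q2; split; first by rewrite addrC.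
have h : p ^+ 2 <= q ^+ 2 by rewrite -p2 -q2 lerXn2r ?nnegrE // ltW.
have := ler_wpM2l (_ : 0 <= q ^+ 2 - p ^+ 2) le2; rewrite subr_ge0 => /(_ h).
have := ler_wpM2l (sqr_ge0 p) UD; rewrite TE ZE; lra.
Qed.

(** * Comparison of marked sites on the path *)

(** Written with successors: the test [i == j.-1] would make site [0] its own neighbour. *)
Definition adjacent (j i : nat) : bool := (i.+1 == j) || (i == j.+1).

Lemma sum_pick (R : pzSemiRingType) (n : nat) (F : nat -> R) (k : nat) :
  \sum_(i < n) F i * (i == k :> nat)%:R = if (k < n)%N then F k else 0.
Proof.
have [kn|kn] := ltnP k n; last first.
  apply: big1 => i _; rewrite ltn_eqF ?mulr0 //.
  exact: leq_trans (ltn_ord i) kn.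
rewrite (bigD1 (Ordinal kn)) //= eqxx mulr1 big1 ?addr0 // => i ik.
by rewrite [_ == k](negPf ik) mulr0.
Qed.

Lemma sum_adjacent (R : pzSemiRingType) (N j : nat) (F : nat -> R) :
  (j <= N)%N ->
  \sum_(i < N.+1) F i * (adjacent j i)%:R =
  (if j == 0%N then 0 else F j.-1) + (if j == N then 0 else F j.+1).
Proof.
move=> jN.
have -> : \sum_(i < N.+1) F i * (adjacent j i)%:R =
    \sum_(i < N.+1) F i * (i.+1 == j)%:R + \sum_(i < N.+1) F i * (i == j.+1 :> nat)%:R.
  rewrite -big_split; apply: eq_bigr => i _ /=; rewrite -mulrDr -natrD /adjacent /=.
  by congr (_ * _%:R); lia.
rewrite sum_pick ltnS; congr (_ + _); last first.
  by rewrite ltn_neqAle jN andbT; case: eqP.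
case: j jN => [|j] jN /=; first by apply: big1 => i _; rewrite mulr0.
by under eq_bigr do rewrite eqSS; rewrite sum_pick ltnS ltnW.
Qed.

(* [f] solves the eigenvalue equation for marked site [j]; [g] is a trial function for marked
   site [1]. *)
Lemma path_ground_state_compare (R : rcfType) (N j : nat) (mu c : R) (f : nat -> R) :
  (2 <= N)%N -> (j <= N)%N -> 0 < mu -> 1 < c ->
  (forall i, (i <= N)%N -> mu * path_op N c f i = (adjacent j i)%:R * f i) ->
  (exists2 i, (i <= N)%N & f i != 0) ->
  exists2 g : nat -> R, (exists2 i, (i <= N)%N & g i != 0)
    & \sum_(i < N.+1) g i * (mu * path_op N c g i) <=
      \sum_(i < N.+1) g i * ((adjacent 1 i)%:R * g i).
Proof.
move=> N2 jN mu0 /dcosh1_surj[x x1 xc] feq [i0 i0N fi0].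
have x_neq0 : x != 0 by rewrite gt_eqF // (lt_trans ltr01).
have N0 : (0 < N)%N by rewrite (leq_trans _ N2).
(* The source strength, so [green x N y / Z] inverts [mu * path_op] exactly. *)
pose Z := mu * (dcosh x (N%:Z + 1) - dcosh x (N%:Z - 1)).
have Z0 : 0 < Z by rewrite mulr_gt0 // subr_gt0 dcosh_lt //; lia.
have greenE y i : (y <= N)%N -> (i <= N)%N ->
    mu * path_op N c (green x N y) i = (i == y)%:R * Z.
  by move=> yN iN; rewrite path_op_green // mulrCA.
(* Green's identity: pairing the equation for [f] with the Green function at [y] expresses [f]
   through its values at the neighbours of [j]. *)
have fE y : (y <= N)%N -> Z * f y =
    (if j == 0%N then 0 else green x N y j.-1 * f j.-1)
    + (if j == N then 0 else green x N y j.+1 * f j.+1).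
  move=> yN; rewrite -(sum_adjacent (fun i => green x N y i * f i) jN).
  transitivity (\sum_(i < N.+1) f i * (mu * path_op N c (green x N y) i)).
    transitivity (if (y < N.+1)%N then Z * f y else 0); first by rewrite ltnS yN.
    rewrite -(sum_pick N.+1 (fun i => Z * f i)); apply: eq_bigr => i _.
    by rewrite greenE ?leq_ord //; ring.
  under eq_bigr do rewrite mulrCA; rewrite -mulr_sumr path_op_sym mulr_sumr.
  apply: eq_bigr => i _; rewrite mulrCA feq ?leq_ord //; ring.
(* It suffices to find source amplitudes [p], [q] at sites [0] and [2], the neighbours of site [1],
   whose Green form is at least [Z] times their squared norm; [g] is the resulting superposition. *)
suff [p [q [pq0 pqle]]] : exists p q : R, 0 < p ^+ 2 + q ^+ 2 /\
    Z * (p ^+ 2 + q ^+ 2) <= p ^+ 2 * green x N 0 0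
      + 2 * p * q * green x N 0 2 + q ^+ 2 * green x N 2 2.
  pose g i := p * green x N 0 i + q * green x N 2 i.
  have gE i : (i <= N)%N -> mu * path_op N c g i =
      p * ((i == 0%N)%:R * Z) + q * ((i == 2)%:R * Z).
    move=> iN; rewrite -!greenE // /path_op /g.
    by case: eqP => _; case: eqP => _; ring.
  have sumL : \sum_(i < N.+1) g i * (mu * path_op N c g i) = Z * (p * g 0%N + q * g 2).
    transitivity (\sum_(i < N.+1) (g i * p * Z) * (i == 0%N :> nat)%:R
        + \sum_(i < N.+1) (g i * q * Z) * (i == 2 :> nat)%:R).
      rewrite -big_split; apply: eq_bigr => i _ /=; rewrite gE ?leq_ord //=; ring.
    rewrite (sum_pick _ (fun i => g i * p * Z)) (sum_pick _ (fun i => g i * q * Z)).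
    by rewrite /= ltnS N2; ring.
  have sumR : \sum_(i < N.+1) g i * ((adjacent 1 i)%:R * g i) = g 0%N ^+ 2 + g 2 ^+ 2.
    transitivity (\sum_(i < N.+1) (g i ^+ 2) * (adjacent 1 i)%:R).
      by apply: eq_bigr => i _; ring.
    rewrite (sum_adjacent (fun i => g i ^+ 2)) //=.
    by have -> : (1 == N)%N = false by lia.
  have formE : p * g 0%N + q * g 2 = p ^+ 2 * green x N 0 0
      + 2 * p * q * green x N 0 2 + q ^+ 2 * green x N 2 2.
    by rewrite /g (greenC x N 2 0); ring.
  rewrite -formE in pqle.
  have s0 : 0 < p * g 0%N + q * g 2 by apply: lt_le_trans pqle; rewrite mulr_gt0.
  exists g; last first.
    rewrite sumL sumR -(ler_pM2l pq0).
    (* Cauchy-Schwarz *)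
    apply: (@le_trans _ _ ((p * g 0%N + q * g 2) ^+ 2)).
      by rewrite mulrA [_ * Z]mulrC expr2 ler_wpM2r // ltW.
    rewrite -subr_ge0 [X in 0 <= X](_ : _ = (p * g 2 - q * g 0%N) ^+ 2); last by ring.
    exact: sqr_ge0.
  have [g0|g0] := eqVneq (g 0%N) 0; last by exists 0%N.
  exists 2; rewrite //; apply: contraTneq s0 => g2.
  by rewrite g0 g2 !mulr0 addr0 ltxx.
(* When [j] is an end it has a single neighbour [k], and [Z] equals the diagonal Green value at [k].
   This is at most the value at [0] since [|N - 2 k| <= N], so [p = 1], [q = 0] work. *)
have one_source k : (k <= N)%N -> (forall y, (y <= N)%N -> Z * f y = green x N y k * f k) ->
    exists p q : R, 0 < p ^+ 2 + q ^+ 2 /\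
    Z * (p ^+ 2 + q ^+ 2) <= p ^+ 2 * green x N 0 0
      + 2 * p * q * green x N 0 2 + q ^+ 2 * green x N 2 2.
  move=> kN fEk.
  have fk : f k != 0.
    apply: contraNneq fi0 => fk; apply/eqP; apply: (mulfI (lt0r_neq0 Z0)).
    by rewrite fEk // fk !mulr0.
  have ZE : Z = green x N k k by apply: (mulIf fk); exact: fEk.
  exists 1, 0; split; first by lra.
  suff : Z <= green x N 0 0 by lra.
  rewrite ZE !green_diag // lerD2l; apply: dcosh_le; lra || lia.
have [j0|j0] := posnP j.
  apply: (one_source 1%N) => // y yN.
  by rewrite fE // j0 eqxx add0r ltn_eqF.
have [jNe|jNe] := eqVneq j N.
  apply: (one_source N.-1) => [|y yN]; first exact: leq_pred.
  by rewrite fE // jNe eqxx addr0 gtn_eqF.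
case: j j0 jN jNe feq fE => // k _ kN kNe feq fE.
have kN' : (k.+2 <= N)%N by lia.
have {}fE y : (y <= N)%N ->
    Z * f y = green x N y k * f k + green x N y k.+2 * f k.+2.
  by move=> yN; rewrite fE // (negPf kNe).
have fk : 0 < f k ^+ 2 + f k.+2 ^+ 2.
  rewrite lt0r paddr_eq0 ?sqr_ge0 // !sqrf_eq0 addr_ge0 ?sqr_ge0 // andbT.
  apply: contra fi0 => /andP[/eqP fk /eqP fk2]; apply/eqP.
  by apply: (mulfI (lt0r_neq0 Z0)); rewrite fE // fk fk2 !mulr0 addr0.
(* The values of [f] at the two neighbours form an eigenvector of the 2x2 Green matrix, with
   eigenvalue [Z]. *)
have fform : Z * (f k ^+ 2 + f k.+2 ^+ 2) = f k ^+ 2 * green x N k k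
    + 2 * f k * f k.+2 * green x N k k.+2 + f k.+2 ^+ 2 * green x N k.+2 k.+2.
  have fk1 := fE k ltac:(lia); have fk2 := fE k.+2 kN'.
  transitivity (Z * f k * f k + Z * f k.+2 * f k.+2); first by ring.
  by rewrite fk1 fk2 (greenC x N k.+2 k); ring.
have [|p [q [pqE pqle]]] :=
    @two_site_form_le R x (f k) (f k.+2) N (N%:Z - k.+1%:Z *+ 2) (ltW x1) N2.
  by lia.
exists p, q; rewrite pqE; split=> //; rewrite fform.
rewrite !green_gap // !green_diag //.
have e1 : N%:Z - k%:Z *+ 2 = N%:Z - k.+1%:Z *+ 2 + 2 by lia.
have e2 : N%:Z - k.+2%:Z *+ 2 = N%:Z - k.+1%:Z *+ 2 - 2 by lia.
have e3 : N%:Z - 0%:Z *+ 2 = N%:Z by lia.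
have e4 : N%:Z - 2%:Z *+ 2 = N%:Z - 4 by lia.
have e5 : N%:Z - 1%:Z *+ 2 = N%:Z - 2 by lia.
(* The [dcosh x N] parts of the diagonal Green values contribute equally on both sides, as the
   squared norms agree. *)
rewrite e1 e2 e3 e4 e5; move: pqle (congr1 ( *%R (dcosh x N%:Z)) pqE). lra.
Qed.

(** * From the matrices to the path operator *)

Lemma end_weight_gt0 (R : numDomainType) (N j : nat) : 0 < end_weight N j :> R.
Proof. by rewrite /end_weight; case: ifP. Qed.

Lemma path_op_shift (R : comPzRingType) (N : nat) (c d : R) (f : nat -> R) (j : nat) :
  path_op N (c + d) f j = path_op N c f j + d * end_weight N j * f j.
Proof. by rewrite /path_op; ring. Qed.

(** The square-root weights absorb the larger couplings at the two ends, making all couplings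
    equal. *)
Lemma Pi_off_weight (R : realType) (N i : nat) : (2 <= N)%N -> (i < N)%N ->
  Num.sqrt (end_weight N i) * Num.sqrt (end_weight N i.+1) * Pi_off R N.+1 i
  = - (1 / 2).
Proof.
move=> N2 iN; rewrite /Pi_off /end_weight subSS.
have s0 : Num.sqrt 2 != 0 :> R by rewrite gt_eqF // sqrtr_gt0.
have ss : Num.sqrt 2 * Num.sqrt 2 = 2 :> R by rewrite -expr2 sqr_sqrtr.
have -> : (i == N) = false by lia.
have -> : (i == N - 1)%N = (i.+1 == N) by lia.
case: (eqVneq i 0%N) => [->|i0] /=.
  have -> : (1 == N)%N = false by lia.
  by rewrite sqrtr1; field.
by case: ifP => _; rewrite ?sqrtr1 ?ss; field.
Qed.

(** The interior weight [2] cancels the factor [1/2], and the end entries have no such factor; the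
    potential becomes a 0/1 indicator. *)
Lemma Piph_diag_weight (R : realType) (N j i : nat) (a : 'I_N.+1 -> bool) :
  (2 <= N)%N -> (j <= N)%N -> (forall k, bit a k = (k == j)) -> (i <= N)%N ->
  end_weight N i * Piph_diag R a i = (adjacent j i)%:R.
Proof.
move=> N2 jN aE iN; rewrite /Piph_diag /end_weight /adjacent !aE subSS /=.
case: (eqVneq i 0%N) => [->|i0] /=; first by rewrite mul1r; congr (_ %:R); lia.
case: (eqVneq i N) => [->|iNe] /=.
  by rewrite mul1r; congr (_ %:R); lia.
by rewrite mulrC divfK ?pnatr_eq0 // -natrD; congr (_ %:R); lia.
Qed.

Definition weighted_row {R : rcfType} (N : nat) (f : nat -> R) : 'rV[R]_N.+1 :=
  \row_i (Num.sqrt (end_weight N i) * f i).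

Lemma weighted_row_surj (R : rcfType) (N : nat) (v : 'rV[R]_N.+1) :
  exists f, v = weighted_row N f.
Proof.
exists (fun i => v 0 (inord i) / Num.sqrt (end_weight N i)).
apply/rowP => i; rewrite mxE inord_val mulrC divfK //.
by rewrite gt_eqF // sqrtr_gt0 end_weight_gt0.
Qed.

Lemma weighted_row_neq0 (R : rcfType) (N : nat) (f : nat -> R) :
  weighted_row N f != 0 <-> exists2 i, (i <= N)%N & f i != 0.
Proof.
split=> [|[i iN fi]].
  case/rV0Pn => i.
  by rewrite mxE mulf_eq0 negb_or => /andP[_ fi]; exists i; rewrite // -ltnS.
apply/rV0Pn; exists (inord i).
by rewrite mxE inordK // mulf_neq0 // gt_eqF // sqrtr_gt0 end_weight_gt0.
Qed.

Lemma weighted_row_norm (R : rcfType) (N : nat) (f : nat -> R) :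
  (weighted_row N f *m (weighted_row N f)^T) 0 0 =
  \sum_(i < N.+1) end_weight N i * f i ^+ 2.
Proof.
rewrite mxE; apply: eq_bigr => i _; rewrite !mxE -expr2 exprMn sqr_sqrtr //.
exact/ltW/end_weight_gt0.
Qed.

(** Multiplying by one more square root clears all radicals, since each matrix entry then carries
    the product of the weights of its row and column. *)
Lemma weighted_row_mulmx (R : realType) (N j : nat) (lam : R)
    (a : 'I_N.+1 -> bool) (f : nat -> R) (i : 'I_N.+1) :
  (2 <= N)%N -> (j <= N)%N -> (forall k, bit a k = (k == j)) ->
  (weighted_row N f *m (Piph_mx R a - lam *: Pi_mx R N.+1)) 0 i
    * Num.sqrt (end_weight N i) =
  (adjacent j i)%:R * f i - lam / 2 * path_op N 1 f i.
Proof.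
move=> N2 jN aE; pose r k : R := Num.sqrt (end_weight N k).
have iN : (i <= N)%N by rewrite -ltnS.
have rr k : r k * r k = end_weight N k.
  by rewrite -expr2 sqr_sqrtr //; exact/ltW/end_weight_gt0.
pose d k := r k * f k * (Piph_diag R a i - lam / 2).
pose up k := r k * f k * (- lam * Pi_off R N.+1 k).
pose dn k := r k * f k * (- lam * Pi_off R N.+1 i).
(* Tridiagonality: only [k = i], [i - 1], [i + 1] contribute. The guard at [i = 0] is essential,
   because [0.-1 = 0] would count the diagonal again. *)
have -> : (weighted_row N f *m (Piph_mx R a - lam *: Pi_mx R N.+1)) 0 i =
    \sum_(k < N.+1) d k * (k == i :> nat)%:R
    + \sum_(k < N.+1) (if i == 0%N :> nat then 0 else up k * (k == i.-1 :> nat)%:R)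
    + \sum_(k < N.+1) dn k * (k == i.+1 :> nat)%:R.
  rewrite -!big_split mxE; apply: eq_bigr => k _ /=; rewrite !mxE /d /up /dn -/(r k).
  have [->|ki] := eqVneq k i.
    rewrite !eqxx.
    have -> : (i == i.+1 :> nat) = false by lia.
    have -> : (if i == 0%N :> nat then 0 else
        r i * f i * (- lam * Pi_off R N.+1 i) * (i == i.-1 :> nat)%:R) = 0.
      case: (eqVneq (i : nat) 0%N) => // i0.
      have -> : (i == i.-1 :> nat) = false by lia.
      exact: mulr0.
    by rewrite !mulrb; ring.
  have -> : (k == i :> nat) = false by apply/negbTE.
  have [->|i0] := eqVneq (i : nat) 0%N.
    by case: (eqVneq (k : nat) 1%N) => _ /=; ring.
  have -> : (k == i.-1 :> nat) = (i == k.+1 :> nat) by lia.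
  have [ik|_] := eqVneq (i : nat) k.+1.
    have -> : (k == i.+1 :> nat) = false by lia.
    by rewrite !mulrb; ring.
  by case: eqP => _; rewrite !mulrb; ring.
rewrite !sum_pick ltnS iN.
have -> : \sum_(k < N.+1) (if i == 0%N :> nat then 0 else up k * (k == i.-1 :> nat)%:R)
   = if i == 0%N :> nat then 0 else up i.-1.
  case: ifP => [_|i0]; first exact: big1.
  by rewrite sum_pick ltnS (leq_trans (leq_pred _) iN).
rewrite -/(r i) !mulrDl.
have -> : d i * r i = (adjacent j i)%:R * f i - lam / 2 * (end_weight N i * f i).
  by rewrite -(Piph_diag_weight R N2 jN aE iN) -!rr /d; ring.
have -> : (if i == 0%N :> nat then 0 else up i.-1) * r i
    = lam / 2 * (if i == 0%N :> nat then 0 else f i.-1).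
  case: (posnP i) => [->|i0]; first by rewrite mul0r mulr0.
  have h : (i.-1 < N)%N by lia.
  have := Pi_off_weight R N2 h; rewrite prednK // -/(r _) -/(r _) => E.
  transitivity (f i.-1 * - lam * (r i.-1 * r i * Pi_off R N.+1 i.-1)).
    by rewrite /up; ring.
  by rewrite E; field.
have -> : (if (i.+1 < N.+1)%N then dn i.+1 else 0) * r i
    = lam / 2 * (if i == N :> nat then 0 else f i.+1).
  rewrite ltnS; case: (ltngtP i N) iN => // [h|->] _; last by rewrite mul0r mulr0.
  have := Pi_off_weight R N2 h; rewrite -/(r _) -/(r _) => E.
  transitivity (f i.+1 * - lam * (r i * r i.+1 * Pi_off R N.+1 i)).
    by rewrite /dn; ring.
  by rewrite E; field.
by rewrite /path_op mul1r !mulrBr !opprD !opprK !addrA.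
Qed.

Lemma Hmx_form (R : realType) (N j : nat) (lam : R)
    (a : 'I_N.+1 -> bool) (f : nat -> R) :
  (2 <= N)%N -> (j <= N)%N -> (forall k, bit a k = (k == j)) ->
  (weighted_row N f *m (Piph_mx R a - lam *: Pi_mx R N.+1)
     *m (weighted_row N f)^T) 0 0 =
  \sum_(i < N.+1) f i * ((adjacent j i)%:R * f i - lam / 2 * path_op N 1 f i).
Proof.
move=> N2 jN aE; rewrite mxE; apply: eq_bigr => i _.
rewrite -(weighted_row_mulmx lam f i N2 jN aE) [(weighted_row _ _)^T _ _]mxE.
by rewrite [weighted_row _ _ _ _]mxE; ring.
Qed.

Lemma Hmx_real_sym (R : realType) (N : nat) (lam : R) (a : 'I_N.+1 -> bool) :
  (Piph_mx R a - lam *: Pi_mx R N.+1)^T = Piph_mx R a - lam *: Pi_mx R N.+1.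
Proof.
apply/matrixP => i k; rewrite !mxE [k == i]eq_sym.
have [->//|ik] := eqVneq i k.
case: (eqVneq (i : nat) k.+1) => [e|_]; case: (eqVneq (k : nat) i.+1) => [e'|_] //.
by lia.
Qed.

(** * Strings of weight one and the final comparison *)

Lemma wt1_bit (L : nat) (a : 'I_L -> bool) : wt a = 1%N ->
  exists j : 'I_L, forall k, bit a k = (k == j).
Proof.
move/eqP/cards1P => [j aj]; exists j => k; rewrite /bit.
case: insubP => [i _ <-|kL].
  by have /setP/(_ i) := aj; rewrite !inE.
by apply/esym/negbTE; apply: contraNneq kL => ->.
Qed.

Lemma e2_bit (L k : nat) : (1 < L)%N -> bit (@e2 L) k = (k == 1%N).
Proof.
move=> L1; rewrite /bit; case: insubP => [i _ <-//|kL].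
by apply/esym/negbTE; apply: contraNneq kL => ->.
Qed.

Theorem theorem3 (R : realType) (L : nat) (lam : R) :
  (3 <= L)%N -> 0 < lam ->
  exists m2 : R[i],
    is_largest_eigenvalue (Hmx lam (@e2 L)) m2 /\
    forall a : 'I_L -> bool, wt a = 1%N ->
      exists m : R[i], is_largest_eigenvalue (Hmx lam a) m /\ m <= m2.
Proof.
case: L => // N; rewrite ltnS => N2 lam0.
have [m2 [m2top _ m2max]] := symmetric_top_eigenvalue (Hmx_real_sym lam (@e2 N.+1)).
have e2E k : bit (@e2 N.+1) k = (k == 1%N) by apply: e2_bit; rewrite ltnS ltnW.
exists (real_complex R m2); split=> // a /wt1_bit[j aE]; have jN := leq_ord j.
have [m [mtop [v v0 vE] _]] := symmetric_top_eigenvalue (Hmx_real_sym lam a).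
exists (real_complex R m); split=> //; rewrite lecR.
(* By the Rayleigh bound for [0100...0], a nonzero trial function with quotient at least [m]
   suffices. *)
suff [g g0 gle] : exists2 g : nat -> R, (exists2 i, (i <= N)%N & g i != 0)
    & m * \sum_(i < N.+1) end_weight N i * g i ^+ 2 <= \sum_(i < N.+1)
        g i * ((adjacent 1 i)%:R * g i - lam / 2 * path_op N 1 g i).
  have := m2max (weighted_row N g); rewrite (Hmx_form _ _ N2 (ltnW N2) e2E) weighted_row_norm.
  move/(le_trans gle); rewrite ler_pM2r //.
  case: g0 => i iN gi; rewrite -ltnS in iN.
  rewrite (bigD1 (Ordinal iN)) //= ltr_pwDl //.
    by rewrite mulr_gt0 ?end_weight_gt0 // lt0r sqr_ge0 sqrf_eq0 gi.
  by apply: sumr_ge0 => k _; rewrite mulr_ge0 ?sqr_ge0 // ltW // end_weight_gt0.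
(* For [m <= 0] the constant function works: the Laplacian annihilates it and the potential is
   nonnegative. *)
have [m_le0|m_gt0] := leP m 0.
  exists (fun=> 1); first by exists 0%N; rewrite ?oner_neq0.
  apply: (@le_trans _ _ 0).
    rewrite mulr_le0_ge0 // sumr_ge0 // => i _.
    by rewrite mulr_ge0 ?sqr_ge0 // ltW // end_weight_gt0.
  apply: sumr_ge0 => i _.
  have -> : path_op N 1 (fun=> 1 : R) i = 0.
    rewrite /path_op /end_weight.
    case: (eqVneq (i : nat) 0%N) => [->|i0] /=.
      have -> : (0 == N)%N = false by lia.
      by ring.
    by case: eqP => _; ring.
  by rewrite mulr0 subr0 mul1r mulr1 ler0n.
(* The term [m w] is absorbed into the constant [1 + 2 * m / lam], which exceeds [1] because [m] and
   [lam] are positive. *)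
have opE (f : nat -> R) i : lam / 2 * path_op N (1 + 2 * m / lam) f i =
    lam / 2 * path_op N 1 f i + m * (end_weight N i * f i).
  by rewrite path_op_shift; field; rewrite gt_eqF.
have [f fE] := weighted_row_surj v; rewrite fE in v0 vE.
have [||||i iN||g g0 gle] := @path_ground_state_compare R N j (lam / 2) (1 + 2 * m / lam) f.
- exact: N2.
- by rewrite -ltnS.
- by rewrite divr_gt0.
- by rewrite ltrDl divr_gt0 // mulr_gt0.
- rewrite opE; have := weighted_row_mulmx lam f (inord i) N2 jN aE.
  rewrite vE !mxE inordK // => E.
  have ww : Num.sqrt (end_weight N i) * Num.sqrt (end_weight N i) = end_weight N i :> R.
    by rewrite -expr2 sqr_sqrtr // ltW // end_weight_gt0.
  have {}E : m * (end_weight N i * f i)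
      = (adjacent j i)%:R * f i - lam / 2 * path_op N 1 f i.
    by rewrite -E -[X in m * (X * _)]ww; ring.
  by rewrite E addrC subrK.
- exact/weighted_row_neq0.
(* Undoing the shift turns the comparison of forms into the required Rayleigh inequality. *)
exists g => //; rewrite -subr_ge0 mulr_sumr -sumrB.
move: gle; rewrite -subr_ge0 -sumrB.
by congr (0 <= _); apply: eq_bigr => i _; rewrite opE; ring.
Qed.
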